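(* Let $E$ be a countable Borel equivalence relation on a standard Borel space $X$. Then the following are equivalent: (1) for every Borel function $\phi\colon X\to\omega^\omega$ there exists a Borel homomorphism $\psi\colon E\to E_0(\omega^\omega)$ such that $\phi(x)\leq^*\psi(x)$ for all $x\in X$; (2) for every Borel homomorphism $\phi\colon X\to(\omega^\omega)^\omega$ from $E$ to $E_{\mathsf{set}}(\omega^\omega)$ there exists a Borel homomorphism $\psi\colon X\to\omega^\omega$ from $E$ to $E_0(\omega^\omega)$ such that $\phi(x)(n)\leq^*\psi(x)$ for all $x\in X$ and all $n\in\omega$.
   Context: A Borel equivalence relation is countable if all its classes are countable. If $E$, $F$ are equivalence relations on standard Borel spaces $X$, $Y$, a Borel homomorphism from $E$ to $F$ (written $f\colon E\to F$) is a Borel function $f\colon X\to Y$ such that $x\mathrel{E}x'$ implies $f(x)\mathrel{F}f(x')$. For $\alpha,\beta\in\omega^\omega$, $\alpha\leq^*\beta$ means $\alpha(n)\leq\beta(n)$ for all but finitely many $n$. $E_0(\omega^\omega)$ is the relation of eventual equality on $\omega^\omega$ (agreement at all but finitely many $n$). $E_{\mathsf{set}}(\omega^\omega)$ is the equivalence relation on $(\omega^\omega)^\omega$ given by $\langle z_n\rangle\mathrel{E_{\mathsf{set}}}\langle z_n'\rangle$ iff $\{z_n:n\in\omega\}=\{z'_n:n\in\omega\}$. Condition (1) is Borel boundedness in the sense of Boykin and Jackson; condition (2) is property $\mathsf{b}$. *)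

(* Defs.v *)
From HB Require Import structures.
From mathcomp Require Import all_boot all_order all_algebra.
From mathcomp Require Import all_classical all_reals all_analysis.

Set Implicit Arguments.
Unset Strict Implicit.
Unset Printing Implicit Defensive.

Local Open Scope classical_set_scope.

(* Completeness is spelled out because the library's [completeType] is pointed,
   which would exclude the empty space. *)
Definition polish (R : realType) (T : metricType R) : Prop :=
  @second_countable T /\
  (forall F : set_system T, ProperFilter F -> cauchy F -> exists l : T, F --> l).

Definition borel (T : topologicalType) : set (set T) := <<s @open T >>.

(* A measurable space is a bare type with a set of subsets, rather than a
   [measurableType], because the latter is pointed.  That [S] is a
   sigma-algebra follows from the isomorphism with the Borel sets of a Polish
   space; up to isomorphism [R] is unique, so its choice is immaterial. *)
Definition standard_borel (R : realType) (X : Type) (S : set (set X)) : Prop :=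
  exists (T : metricType R) (f : X -> T),
    [/\ polish T, bijective f & S = [set f @^-1` B | B in @borel T]].

Definition borel_fun (X Y : Type) (SX : set (set X)) (SY : set (set Y))
    (f : X -> Y) : Prop :=
  forall B, SY B -> SX (f @^-1` B).

Definition borel_hom (X Y : Type) (SX : set (set X)) (SY : set (set Y))
    (E : X -> X -> Prop) (F : Y -> Y -> Prop) (f : X -> Y) : Prop :=
  borel_fun SX SY f /\ forall x x', E x x' -> F (f x) (f x').

Definition product_sigma (X Y : Type) (SX : set (set X)) (SY : set (set Y)) :
    set (set (X * Y)) :=
  <<s [set A `*` B | A in SX & B in SY] >>.

Definition countable_borel_equivalence (X : Type) (S : set (set X))
    (E : X -> X -> Prop) : Prop :=
  [/\ RelationClasses.Equivalence E,
      product_sigma S S [set p | E p.1 p.2] &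
      forall x, countable [set y | E x y]].

(* [nat] is discrete and [{ptws _ -> _}] carries the product topology. *)
Definition baire : topologicalType := {ptws nat -> nat}.
Definition baire_seq : topologicalType := {ptws nat -> baire}.

Definition le_star (a b : nat -> nat) : Prop :=
  finite_set [set n | ~ (a n <= b n)%N].

Definition E0 (a b : nat -> nat) : Prop :=
  finite_set [set n | a n <> b n].

Definition Eset (z z' : nat -> nat -> nat) : Prop :=
  range z = range z'.

(* Main.v *)
Require Import Defs.
From mathcomp Require Import all_boot all_order all_algebra.
From mathcomp Require Import all_classical all_reals all_analysis.
From mathcomp Require Import lra.

(** If [E] is Borel bounded, all the [phi x n] can be bounded at once: [phi x n]
    lies eventually below the diagonal maximum [k |-> max_(n <= k) phi x n k],
    which is Borel in [x], and a bound for this maximum is the required [psi].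

    From property b to Borel boundedness, the point is that the classes of [E]
    have a Borel enumeration: Borel maps [e j : X -> X] whose values at [x] run
    through the class of [x] ([class_enumeration]). Then [x |-> (phi (e j x))_j]
    has range [phi] of the class of [x], so it is a homomorphism to [Eset], and
    a bound for all its terms is a bound for [phi x], because [x] is one of the
    [e j x].

    The enumeration is an instance of the Lusin-Novikov theorem: a Borel set in
    a plane of irrationals with countable vertical sections is covered by
    countably many graphs of Borel functions ([borel_uniformization]).  It is
    proved in two steps.

    - For closed sets ([closed_uniformization]).  Let [F] be closed with
      countable sections.  Finite attempts at building a point [a] together
      with a perfect tree of branches in the section [F a] form a countable
      tree of nodes.  An infinite run of attempts would produce a section that
      no sequence enumerates, so the tree is well founded ([root_acc]).
      Well-founded induction along it replaces the transfinite iteration of the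
      Cantor-Bendixson derivative: each node receives a Borel derivative of the
      tree of [F a], and a point that falls out of a derivative was, just
      before, an isolated branch, hence can be read off from [a] in a Borel way
      ([acc_decomposition]).  Since the index set is countable, no bound on
      ranks has to be computed and no separation theorem for analytic sets is
      used.

    - From Borel to closed ([borel_closed_graph]).  Every Borel set [B] is
      decided by a function with closed graph: [a] belongs to [B] when the first
      value of [g a] is nonzero.  Replacing a point [b] of the section by the
      pair of [b] and [g (a, b)] turns a Borel set into a closed one without
      enlarging its sections.

    Finally a standard Borel space embeds in the Baire space with Borel image
    ([standard_borel_code]), which carries [E] to a Borel set of pairs. *)

Set Implicit Arguments.
Unset Strict Implicit.
Unset Printing Implicit Defensive.

Import Order.TTheory GRing.Theory Num.Theory.

Local Open Scope classical_set_scope.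

(** * Countably valued measurable functions *)

(** The minimum of a set of naturals, with value [0] on the empty set so that
    it is total and its fibers are Boolean combinations of the [P k]. *)
Definition least (P : nat -> Prop) : nat :=
  if pselect (exists k, `[< P k >]) is left h then ex_minn h else 0.

Lemma leastP (P : nat -> Prop) k0 : P k0 ->
  P (least P) /\ forall j, P j -> (least P <= j)%N.
Proof.
move=> Pk0; rewrite /least; case: pselect => [h|]; last first.
  by case; exists k0; apply/asboolP.
by case: ex_minnP => m /asboolP Pm mmin; split => // j /asboolP /mmin.
Qed.

Lemma least0 (P : nat -> Prop) : (forall k, ~ P k) -> least P = 0.
Proof.
move=> nP; rewrite /least; case: pselect => // h.
by exfalso; case: h => k /asboolP; exact: nP.
Qed.

Lemma least_eqE (P : nat -> Prop) k : least P = k <->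
  (P k /\ forall j, (j < k)%N -> ~ P j) \/ (k = 0 /\ forall j, ~ P j).
Proof.
have [[k0 Pk0]|/forallNP nP] := pselect (exists k0, P k0).
  have [Pl lmin] := leastP Pk0; split=> [<-|[[Pk kmin]|[_ /(_ k0)]//]].
    by left; split=> // j jl /lmin; rewrite leqNgt jl.
  apply/eqP; rewrite eqn_leq lmin //= leqNgt; apply/negP => /kmin; exact.
rewrite (least0 nP); split=> [<-|[[/nP]//|[]//]]; by right.
Qed.

(** For countable [Y] this is measurability with respect to all subsets of [Y]
    ([fibers_pred]); products, images and finite sequences of such functions
    are again of this kind, so most measurability proofs reduce to it. *)
Definition measurable_fibers (X : Type) (S : set (set X)) (Y : Type)
  (g : X -> Y) := forall y, S [set x | g x = y].

Section SigmaAlgebra.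
Context {X : Type} {S : set (set X)} (hS : sigma_algebra setT S).

Lemma sigma_cst (P : Prop) : S [set _ | P].
Proof.
case: hS => S0 SC _; have [p|np] := pselect P.
  suff -> : [set _ : X | P] = setT `\` set0 by apply: SC.
  by rewrite setD0; apply/seteqP; split.
by suff -> : [set _ : X | P] = set0; last by apply/seteqP; split.
Qed.

Lemma sigma_not (P : X -> Prop) : S [set x | P x] -> S [set x | ~ P x].
Proof.
case: hS => _ SC _ /SC; congr S; apply/seteqP; split => x //=.
by case.
Qed.

(** Countable unions indexed by any countable type: the terms are listed along
    the codes of the indices, with an empty term where no index has
    that code. *)
Lemma sigma_exists (I : countType) (P : I -> X -> Prop) :
  (forall i, S [set x | P i x]) -> S [set x | exists i, P i x].
Proof.
move=> SP; case: (hS) => _ _ SU.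
rewrite (_ : mkset _ =
  \bigcup_n [set x | exists2 i, unpickle n = Some i & P i x]).
  apply: SU => n; case: (unpickle n) => [i|].
    rewrite (_ : mkset _ = [set x | P i x]) //.
    by apply/seteqP; split=> x /= => [[j [->]]|Pi] //; exists i.
  rewrite (_ : mkset _ = [set x | False]); first exact: sigma_cst.
  by apply/seteqP; split=> x //= -[].
apply/seteqP; split=> x /= => [[i Pi]|[n _ [i _ Pi]]]; last by exists i.
by exists (pickle i) => //; exists i => //; rewrite pickleK.
Qed.

Lemma sigma_forall (I : countType) (P : I -> X -> Prop) :
  (forall i, S [set x | P i x]) -> S [set x | forall i, P i x].
Proof.
move=> SP; rewrite (_ : mkset _ = [set x | ~ exists i, ~ P i x]).
  by apply: sigma_not; apply: sigma_exists => i; exact: sigma_not.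
apply/seteqP; split=> x /= => [Px [i]|/forallNP Px i]; first exact.
exact: contrapT.
Qed.

Lemma sigma_and (P Q : X -> Prop) :
  S [set x | P x] -> S [set x | Q x] -> S [set x | P x /\ Q x].
Proof.
move=> SP SQ.
rewrite (_ : mkset _ = [set x | forall b : bool, if b then P x else Q x]).
  by apply: sigma_forall; case.
apply/seteqP; split=> x /= => [[p q] []//|H].
by split; [exact: (H true)|exact: (H false)].
Qed.

Lemma sigma_or (P Q : X -> Prop) :
  S [set x | P x] -> S [set x | Q x] -> S [set x | P x \/ Q x].
Proof.
move=> SP SQ.
rewrite (_ : mkset _ = [set x | exists b : bool, if b then P x else Q x]).
  by apply: sigma_exists; case.
apply/seteqP; split=> x /= => [[p|q]|[[] p]].
- by exists true.
- by exists false.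
- by left.
- by right.
Qed.

Lemma sigma_imp (P : Prop) (Q : X -> Prop) :
  S [set x | Q x] -> S [set x | P -> Q x].
Proof.
move=> SQ; have [p|np] := pselect P.
  by move: SQ; congr S; apply/seteqP; split=> x //= /(_ p).
rewrite (_ : mkset _ = [set _ | True]); first exact: sigma_cst.
by apply/seteqP; split=> x //= _ /np.
Qed.

Lemma fibers_pred (Y : countType) (g : X -> Y) (P : Y -> Prop) :
  measurable_fibers S g -> S [set x | P (g x)].
Proof.
move=> dg; rewrite (_ : mkset _ = [set x | exists y, g x = y /\ P y]).
  by apply: sigma_exists => y; apply: sigma_and; [exact: dg|exact: sigma_cst].
by apply/seteqP; split=> x /= => [Pg|[y [->]]//]; exists (g x).
Qed.

Lemma fibers_comp (Y : countType) (Z : Type) (g : X -> Y) (h : Y -> Z) :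
  measurable_fibers S g -> measurable_fibers S (fun x => h (g x)).
Proof. by move=> dg z; exact: (fibers_pred (fun y => h y = z)). Qed.

Lemma fibers_pair (Y Z : Type) (g : X -> Y) (h : X -> Z) :
  measurable_fibers S g -> measurable_fibers S h ->
  measurable_fibers S (fun x => (g x, h x)).
Proof.
move=> dg dh [y z].
rewrite (_ : mkset _ = [set x | g x = y /\ h x = z]); first exact: sigma_and.
by apply/seteqP; split=> x /= [-> ->].
Qed.

Lemma fibers_mkseq (Y : countType) (g : X -> nat -> Y) n :
  (forall i, measurable_fibers S (g^~ i)) ->
  measurable_fibers S (fun x => mkseq (g x) n).
Proof.
move=> dg; elim: n => [|n IH]; first by move=> s; exact: (sigma_cst ([::] = s)).
under [X in measurable_fibers _ X]eq_fun do rewrite mkseqS.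
exact: (fibers_comp (fun p => rcons p.1 p.2) (fibers_pair IH (dg n))).
Qed.

Lemma fibers_least (P : X -> nat -> Prop) :
  (forall k, S [set x | P x k]) -> measurable_fibers S (fun x => least (P x)).
Proof.
move=> SP k; rewrite (_ : mkset _ = [set x |
    (P x k /\ forall j, (j < k)%N -> ~ P x j) \/ (k = 0 /\ forall j, ~ P x j)]).
  apply: sigma_or; apply: sigma_and => //; last 1 first.
  - by apply: sigma_forall => j; apply: sigma_not.
  - by apply: sigma_forall => j; apply: sigma_imp; apply: sigma_not.
  - exact: sigma_cst.
by apply/seteqP; split=> x /= /least_eqE.
Qed.

End SigmaAlgebra.

(** * The Borel sets of the Baire space, by cylinders *)

Definition cylinders : set (set (nat -> nat)) :=
  [set A | exists n k, A = [set a | a n = k]].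
Definition cyl_borel : set (set (nat -> nat)) := <<s cylinders >>.

Lemma cyl_sigma : sigma_algebra setT cyl_borel.
Proof. exact: smallest_sigma_algebra. Qed.
#[local] Hint Resolve cyl_sigma : core.

Lemma fibers_coord n : measurable_fibers cyl_borel (fun a => a n).
Proof. by move=> k; apply: sub_sigma_algebra; exists n, k. Qed.

Lemma cyl_borel_preimage (X : Type) (S : set (set X)) (c : X -> nat -> nat) B :
  sigma_algebra setT S -> (forall n, measurable_fibers S (c^~ n)) ->
  cyl_borel B -> S [set x | B (c x)].
Proof.
move=> hS dc; suff : cyl_borel `<=` [set B | S [set x | B (c x)]] by exact.
apply: smallest_sub; last by move=> _ [n [k ->]]; exact: dc.
split.
- exact: (sigma_cst hS False).
- move=> A SA /=; rewrite (_ : mkset _ = [set x | ~ A (c x)]).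
    exact: sigma_not.
  by apply/seteqP; split=> x //=; case.
- move=> A SA /=.
  rewrite (_ : mkset _ = [set x | exists n, A n (c x)]).
    exact: (sigma_exists hS).
  by apply/seteqP; split=> x /= [n]; exists n.
Qed.

(** Stated on finite sequences, so that a property of the first [n] values of
    [a] is visibly a function of [mkseq a n]. *)
Definition agree n (a b : nat -> nat) := mkseq a n = mkseq b n.

Lemma agreeP n a b : agree n a b <-> forall i, (i < n)%N -> a i = b i.
Proof.
split=> [ab i ltin|ab]; first by rewrite -(nth_mkseq 0 a ltin) ab nth_mkseq.
by apply/eq_in_map => i; rewrite mem_iota => /andP[_]; exact: ab.
Qed.

(** * Uniformization of closed relations with countable sections *)

Lemma countable_enum (T : Type) (t0 : T) (A : set T) : countable A ->
  exists e : nat -> T, forall z, A z -> exists n, e n = z.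
Proof.
move=> /countable_injP[f finj].
have [e eP] : {e : nat -> T & forall n z, A z -> f z = n -> e n = z}.
  apply: (@choice _ _ (fun n t => forall z, A z -> f z = n -> t = z)) => n.
  have [[t [At ft]]|nt] := pselect (exists t, A t /\ f t = n).
    by exists t => z Az fz; apply: finj; rewrite ?inE // ft fz.
  by exists t0 => z Az fz; case: nt; exists z.
by exists e => z Az; exists (f z); exact: eP.
Qed.

Definition initial (s : seq nat) (z : nat -> nat) :=
  forall i, (i < size s)%N -> nth 0 s i = z i.

Definition extends (s t : seq nat) :=
  (size s <= size t)%N /\ initial s (nth 0 t).

Definition incompatible (s t : seq nat) :=
  exists i, [/\ (i < size s)%N, (i < size t)%N & nth 0 s i <> nth 0 t i].

Lemma initial_mkseq z n : initial (mkseq z n) z.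
Proof. by move=> i; rewrite size_mkseq => ltin; rewrite nth_mkseq. Qed.

Lemma extends_trans s t r : extends s t -> extends t r -> extends s r.
Proof.
move=> [st Hst] [tr Htr]; split; first exact: leq_trans tr.
by move=> i ltis; rewrite Hst // Htr // (leq_trans ltis).
Qed.

Lemma incompatible_extends s t0 t1 :
  extends s t0 -> extends s t1 -> incompatible t0 t1 ->
  (size s < size t0)%N /\ (size s < size t1)%N.
Proof.
move=> [_ e0] [_ e1] [i [i0 i1 neq]].
have si : (size s <= i)%N.
  by rewrite leqNgt; apply/negP => lt; apply: neq; rewrite -e0 // e1.
by split; apply: leq_ltn_trans si _.
Qed.

Lemma incompatible_initial t0 t1 z :
  incompatible t0 t1 -> initial t0 z -> ~ initial t1 z.
Proof. by move=> [i [i0 i1 neq]] h0 h1; apply: neq; rewrite h0 // h1. Qed.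

Section ClosedUniformization.
Variable F : (nat -> nat) -> (nat -> nat) -> Prop.

(** Closedness in the product of two Baire spaces, by basic neighborhoods. *)
Definition closed_rel := forall a z,
  (forall n, exists a' z', [/\ F a' z', agree n a' a & agree n z' z]) -> F a z.

(** A node is a finite attempt at a point together with a perfect tree in the
    section above it: an initial segment of the point, and the finite sequences
    forming the current level of the tree. *)
Definition node := (seq nat * seq (seq nat))%type.

(** The point and the segment are compared only below the length of [s], which
    may be shorter than the segment: members of [trace a] are compatible with
    [a] up to their own length only, and they have to form viable nodes. *)
Definition viable (p : node) := forall s, s \in p.2 -> exists a z,
  [/\ F a z,
      forall i, (i < size p.1)%N -> (i < size s)%N -> nth 0 p.1 i = a i
    & initial s z].

Definition child (q p : node) := [/\ viable q,
  exists k, q.1 = rcons p.1 k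
  & forall s, s \in p.2 -> exists t0 t1, [/\ t0 \in q.2, t1 \in q.2,
      extends s t0, extends s t1 & incompatible t0 t1]].

(** Suppose that there is an infinite run of children.  It determines a point
    [a], and its levels contain a full binary tree all of whose branches lie in
    [F a] because [F] is closed.  Given an enumeration [e] of [F a], follow the
    branch which at stage [k] goes to a successor that is not an initial segment
    of [e k]; such a successor exists since the two on offer are incompatible.
    The resulting branch is in [F a] and differs from every [e k]. *)
Lemma root_acc : closed_rel -> (forall a, countable [set z | F a z]) ->
  Acc child ([::], [:: [::]]).
Proof.
move=> clF cntF; apply: contrapT => nacc.
have [nx nxP] : {nx : node -> node &
    forall p, ~ Acc child p -> child (nx p) p /\ ~ Acc child (nx p)}.
  apply: (@choice _ _ (fun p q => ~ Acc child p -> child q p /\ ~ Acc child q)).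
  move=> p; have [h|h] := pselect (Acc child p); first by exists p.
  have [[q qP]|/forallNP nq] := pselect (exists q, child q p /\ ~ Acc child q).
    by exists q.
  exfalso; apply: h; constructor => q qp; apply: contrapT => nq'.
  exact: (nq q).
(* The infinite run of children, and the point [a] that it determines. *)
pose P n := iter n nx ([::], [:: [::]]).
have PN n : ~ Acc child (P n) by elim: n => //= n /nxP[].
have Pc n : child (P n.+1) (P n) by have [] := nxP _ (PN n).
have sP n : size (P n).1 = n.
  by elim: n => // n IH; have [_ [k ->] _] := Pc n; rewrite size_rcons IH.
pose a i := nth 0 (P i.+1).1 i.
have aP n i : (i < n)%N -> nth 0 (P n).1 i = a i.
  elim: n => // n IH; rewrite ltnS leq_eqVlt => /predU1P[->//|ltin].
  by have [_ [k ->] _] := Pc n; rewrite nth_rcons sP ltin IH.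
have [e eP] := countable_enum (fun=> 0) (cntF a).
have [ns nsP] : {ns : nat * seq nat -> seq nat & forall ks,
    ks.2 \in (P ks.1).2 -> [/\ ns ks \in (P ks.1.+1).2, extends ks.2 (ns ks),
      (size ks.2 < size (ns ks))%N & ~ initial (ns ks) (e ks.1)]}.
  apply: (@choice _ _ (fun ks s' => ks.2 \in (P ks.1).2 ->
    [/\ s' \in (P ks.1.+1).2, extends ks.2 s',
      (size ks.2 < size s')%N & ~ initial s' (e ks.1)])) => -[k s] /=.
  have [sk|] := boolP (s \in (P k).2); last by exists [::].
  have [_ _ /(_ _ sk)[t0 [t1 [t0k t1k e0 e1 inc]]]] := Pc k.
  have [lt0 lt1] := incompatible_extends e0 e1 inc.
  have [i0|ni0] := pselect (initial t0 (e k)); last by exists t0.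
  by exists t1 => _; split => //; exact: incompatible_initial i0.
(* The diagonal branch, which leaves [e n] at stage [n]. *)
pose s := fix s n := if n is n'.+1 then ns (n', s n') else [::].
have sn n : s n \in (P n).2.
  by elim: n => [|n IH]; [rewrite inE|have [] := nsP (n, s n) IH].
have s_ext n : extends (s n) (s n.+1) by have [] := nsP (n, s n) (sn n).
have s_size n : (n <= size (s n))%N.
  elim: n => // n IH; apply: leq_ltn_trans IH _.
  by have [] := nsP (n, s n) (sn n).
have s_mono m n : (m <= n)%N -> extends (s m) (s n).
  elim: n => [|n IH]; first by rewrite leqn0 => /eqP ->; split.
  rewrite leq_eqVlt => /predU1P[->|]; first by split.
  by rewrite ltnS => /IH smn; exact: extends_trans (s_ext n).
pose z n := nth 0 (s n.+1) n.
have zP n : initial (s n) z.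
  move=> i ltin; rewrite /z; have [lein|ltni] := leqP n i.+1.
    by have [_ ->] := s_mono _ _ lein.
  by have [_ <-//] := s_mono _ _ (ltnW ltni); exact: s_size.
have [k ek] : exists k, e k = z.
  apply: eP; apply: clF => n; have [+ _ _] := Pc n.
  (* The sequence [s n.+1] has length above [n], so viability gives a point of
     [F] that agrees with [(a, z)] up to [n]. *)
  move=> /(_ _ (sn n.+1))[a' [z' [Fa'z' a'a z'z]]].
  exists a', z'; split => //; apply/agreeP => i ltin.
    have lti1 : (i < n.+1)%N by exact: ltnW.
    rewrite -a'a ?sP ?(leq_trans lti1) //; exact: aP.
  by rewrite -z'z ?zP // (leq_trans (ltnW _) (s_size n.+1)).
by have [_ _ _] := nsP (k, s k) (sn k); rewrite /= ek; apply; exact: (zP k.+1).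
Qed.

(** The tree of [F], restricted to the sequences compatible with [a].  A
    sequence of length [n] is tested against the first [n] values of [a] only,
    so each condition is clopen in [a]; the price is that [trace a] may have
    dead ends. *)
Definition trace (a : nat -> nat) (s : seq nat) := exists a' z',
  [/\ F a' z', agree (size s) a' a & initial s z'].

Lemma trace_measurable s : cyl_borel [set a | trace a s].
Proof.
exact: (fibers_pred cyl_sigma (fun t => exists a' z',
  [/\ F a' z', mkseq a' (size s) = t & initial s z'])
  (fibers_mkseq cyl_sigma (size s) fibers_coord)).
Qed.

(** The Cantor-Bendixson derivative for trees that may have dead ends: asking
    for two extensions in the tree, and not for two branches, keeps it Borel. *)
Definition split_rel (D : (nat -> nat) -> seq nat -> Prop) a s :=
  exists t0 t1, [/\ D a t0, D a t1, extends s t0, extends s t1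
    & incompatible t0 t1].

Definition measurable_family (f : nat -> (nat -> nat) -> nat -> nat) :=
  forall j n, measurable_fibers cyl_borel (fun a => f j a n).

(** What the induction along the nodes provides. At the root the level consists
    of the empty sequence, an initial segment of everything, so the second
    clause expels every branch from [D a], and the functions of the last clause
    recover all of [F a]. *)
Definition decomposition (p : node)
    (D : (nat -> nat) -> seq nat -> Prop)
    (f : nat -> (nat -> nat) -> nat -> nat) :=
  [/\ forall s, cyl_borel [set a | D a s],
      forall a, initial p.1 a -> exists2 s, s \in p.2 & ~ D a s,
      measurable_family f
    & forall a z n, F a z -> ~ D a (mkseq z n) -> exists j, f j a = z].

(** Let [D'] be the intersection of the tree of [F] with the sets attached to
    all children of [p], and attach to [p] the derivative of [D'].  If the whole
    level of [p] survived in the derivative at some [a], the witnessing pairs of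
    extensions would form a child of [p] whose level lies in [D' a], hence in
    the set attached to that child, contradicting the induction hypothesis.  If
    a branch [z] of [F a] leaves the derivative, then either it already leaves
    the set of some child, and a function of that child recovers it; or it stays
    in [D' a] and has an initial segment all of whose extensions in [D' a] are
    compatible, and then [z] is the union of these extensions. *)
Lemma acc_decomposition p : Acc child p -> exists D f, decomposition p D f.
Proof.
elim=> {}p _ IH.
have [Df DfP] : {Df : node -> ((nat -> nat) -> seq nat -> Prop) *
    (nat -> (nat -> nat) -> nat -> nat) &
    forall q, child q p -> decomposition q (Df q).1 (Df q).2}.
  apply: (@choice _ _ (fun q Df =>
    child q p -> decomposition q Df.1 Df.2)) => q.
  have [qp|nqp] := pselect (child q p); last first.
    by exists ((fun _ _ => True), (fun _ _ _ => 0)).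
  by have [D [f Df]] := IH q qp; exists (D, f).
pose D' a s := trace a s /\ forall q, child q p -> (Df q).1 a s.
have D'meas s : cyl_borel [set a | D' a s].
  apply: (sigma_and cyl_sigma) => //; first exact: trace_measurable.
  apply: (sigma_forall cyl_sigma) => q.
  have [qp|nqp] := pselect (child q p).
    by apply: (sigma_imp cyl_sigma) => //; have [] := DfP q qp.
  rewrite (_ : mkset _ = [set _ | True]); first exact: (sigma_cst cyl_sigma).
  by apply/seteqP; split=> a //= _ /nqp.
have Dmeas s : cyl_borel [set a | split_rel D' a s].
  apply: (sigma_exists cyl_sigma) => t0.
  apply: (sigma_exists cyl_sigma) => t1.
  pose C := [/\ extends s t0, extends s t1 & incompatible t0 t1].
  rewrite (_ : mkset _ = [set a | (D' a t0 /\ D' a t1) /\ C]).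
    apply: (sigma_and cyl_sigma); first exact: (sigma_and cyl_sigma).
    exact: (sigma_cst cyl_sigma).
  by apply/seteqP; split=> a /= => [[? ? ? ? ?]|[[? ?] [? ? ?]]].
(* If the extensions of [s] in [D' a] are pairwise compatible, [h s a] is their
   union. *)
pose h s a n := least (fun k => exists t,
  [/\ D' a t, extends s t, (n < size t)%N & nth 0 t n = k]).
have hmeas s n : measurable_fibers cyl_borel (fun a => h s a n).
  apply: (fibers_least cyl_sigma) => k; apply: (sigma_exists cyl_sigma) => t.
  pose C := [/\ extends s t, (n < size t)%N & nth 0 t n = k].
  rewrite (_ : mkset _ = [set a | D' a t /\ C]).
    by apply: (sigma_and cyl_sigma) => //; exact: (sigma_cst cyl_sigma).
  by apply/seteqP; split=> a /= => [[? ? ? ?]|[? [? ? ?]]].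
pose f j : (nat -> nat) -> nat -> nat :=
  match @unpickle (node * nat + seq nat)%type j with
  | Some (inl (q, i)) => if `[< child q p >] then (Df q).2 i else fun _ _ => 0
  | Some (inr s) => h s
  | None => fun _ _ => 0
  end.
exists (split_rel D'), f; split=> //.
- move=> a ua; apply: contrapT => nD.
  have {}nD s : s \in p.2 -> split_rel D' a s.
    by move=> sp; apply: contrapT => nDs; apply: nD; exists s.
  have [tt ttP] : {tt : seq nat -> seq nat * seq nat & forall s, s \in p.2 ->
      [/\ D' a (tt s).1, D' a (tt s).2, extends s (tt s).1, extends s (tt s).2
        & incompatible (tt s).1 (tt s).2]}.
    apply: (@choice _ _ (fun s tt => s \in p.2 ->
      [/\ D' a tt.1, D' a tt.2, extends s tt.1, extends s tt.2
        & incompatible tt.1 tt.2])) => s.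
    have [sp|] := boolP (s \in p.2); last by exists ([::], [::]).
    by have [t0 [t1 t01]] := nD s sp; exists (t0, t1).
  (* The child formed by the witnesses of the splittings. *)
  pose q : node := (rcons p.1 (a (size p.1)),
    [seq (tt s).1 | s <- p.2] ++ [seq (tt s).2 | s <- p.2]).
  have qa : initial q.1 a.
    move=> i; rewrite size_rcons ltnS nth_rcons => lei.
    case: ltnP => [/ua //|lepi].
    have /eqP ei : i == size p.1 by rewrite eqn_leq lei.
    by rewrite ei eqxx.
  have qD t : t \in q.2 -> D' a t.
    by rewrite mem_cat => /orP[] /mapP[s sp ->]; have [] := ttP s sp.
  have qp : child q p.
    split; [|by exists (a (size p.1))|].
    - move=> t tq; have [[a' [z' [Fa' /agreeP a'a tz]]] _] := qD t tq.
      by exists a', z'; split => // i iq it; rewrite a'a //; exact: qa.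
    - move=> s sp; have [d0 d1 e0 e1 inc] := ttP s sp.
      exists (tt s).1, (tt s).2; split => //; rewrite mem_cat.
        by apply/orP; left; apply: map_f.
      by apply/orP; right; apply/mapP; exists s.
  have [_ /(_ _ qa)[t tq nDt] _ _] := DfP q qp; apply: nDt.
  by have [_] := qD t tq; apply.
- move=> j n; rewrite /f; case: (unpickle j) => [[[q i]|s]|].
  + case: asboolP => [qp|_]; last first.
      by move=> k; exact: (sigma_cst cyl_sigma (0 = k)).
    have [_ _ mf _] := DfP q qp; exact: mf.
  + exact: hmeas.
  + by move=> k; exact: (sigma_cst cyl_sigma (0 = k)).
- move=> a z n Faz nD.
  have trz m : trace a (mkseq z m).
    by exists a, z; split => //; exact: initial_mkseq.
  have [D'z|/existsNP[m nD'm]] := pselect (forall m, D' a (mkseq z m));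
    last first.
    have [q [qp nDq]] : exists q, child q p /\ ~ (Df q).1 a (mkseq z m).
      apply: contrapT => /forallNP nq; apply: nD'm; split=> // q qp.
      by apply: contrapT => nDq; apply: (nq q).
    have [_ _ _ /(_ _ _ _ Faz nDq)[i iz]] := DfP q qp.
    exists (pickle (inl (q, i) : node * nat + seq nat)).
    by rewrite /f pickleK asboolT.
  exists (pickle (inr (mkseq z n) : node * nat + seq nat)); rewrite /f pickleK.
  (* An extension of [mkseq z n] in [D' a] whose value at [i] differed from
     [z i] would be incompatible with [mkseq z N]. *)
  apply/funext => i; rewrite /h; pose N := maxn n i.+1.
  have ext : extends (mkseq z n) (mkseq z N).
    split=> [|j]; rewrite ?size_mkseq ?leq_maxl // => ltjn.
    by rewrite !nth_mkseq // (leq_trans ltjn) // leq_maxl.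
  have iN : (i < N)%N by rewrite leq_max leqnn orbT.
  pose P k := exists t,
    [/\ D' a t, extends (mkseq z n) t, (i < size t)%N & nth 0 t i = k].
  have Pz : P (z i).
    by exists (mkseq z N); split; rewrite ?size_mkseq ?nth_mkseq.
  have [+ _] := leastP Pz.
  move=> [t [Dt et it <-]]; apply: contrapT => neq; apply: nD.
  exists t, (mkseq z N); split => //; exists i.
  by rewrite size_mkseq nth_mkseq.
Qed.

Lemma closed_uniformization :
  closed_rel -> (forall a, countable [set z | F a z]) ->
  exists2 f, measurable_family f & forall a z, F a z -> exists j, f j a = z.
Proof.
move=> clF cntF.
have [D [f [_ rD mf fP]]] := acc_decomposition (root_acc clF cntF).
exists f => // a z Faz; apply: (fP a z 0 Faz).
have [//|s + nDs] := rD a; rewrite inE => /eqP se.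
by move: nDs; rewrite se.
Qed.

End ClosedUniformization.

(** * Borel sets as projections of closed graphs, and Borel uniformization *)

Lemma agree_leq m n a b : (m <= n)%N -> agree n a b -> agree m a b.
Proof.
move=> lemn /agreeP ab; apply/agreeP => i ltim.
by apply: ab; exact: leq_trans lemn.
Qed.

(** Such a [g] need not be continuous, but its value at [a] is singled out by a
    closed condition, and so serves as a unique witness. *)
Definition closed_graph (g : (nat -> nat) -> nat -> nat) :=
  forall a w, (forall n, exists a', agree n a' a /\ agree n (g a') w) ->
  g a = w.

Lemma closed_graph_cylinder n k :
  closed_graph (fun a _ => nat_of_bool (a n == k)).
Proof.
move=> a w H; apply/funext => i.
have [a' [/agreeP a'a /agreeP <-]] := H (maxn n i).+1.
  by rewrite a'a // ltnS leq_maxl.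
by rewrite ltnS leq_maxr.
Qed.

(** Shifting [g a] by one leaves room for the negated answer while keeping the
    witness. *)
Lemma closed_graph_complement g : closed_graph g ->
  closed_graph
    (fun a i => if i is i'.+1 then g a i' else nat_of_bool (g a 0 == 0)).
Proof.
move=> cg a w H.
have gaE : g a = fun i => w i.+1.
  apply: cg => n; have [a' [a'a /agreeP gw]] := H n.+1.
  exists a'; split; first exact: agree_leq a'a.
  by apply/agreeP => i ltin; rewrite -gw.
apply/funext => -[|i]; last by rewrite gaE.
have [a' [_ /agreeP gw]] := H 2.
by rewrite gaE -(gw 0) // -(gw 1).
Qed.

(** The flag in front records the least [m] for which [g m a 0] is nonzero,
    rather than only whether there is one: with a two-valued flag the graph
    need not be closed. *)
Definition merge_graphs (g : nat -> (nat -> nat) -> nat -> nat)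
    (a : nat -> nat) (i : nat) : nat :=
  if i is j.+1 then
    if unpickle j is Some (m, k) then g m a k else 0
  else if pselect (exists m, g m a 0 <> 0)
    then (least (fun m => g m a 0 <> 0)).+1
  else 0.

Lemma merge_graphs_nonzero g a :
  merge_graphs g a 0 <> 0 <-> exists m, g m a 0 <> 0.
Proof. by rewrite /merge_graphs; case: pselect => h; split. Qed.

Lemma merge_graphs_component g a m k :
  merge_graphs g a (pickle (m, k)).+1 = g m a k.
Proof. by rewrite /merge_graphs pickleK. Qed.

(** The witnesses converge to those of the limit since the [g m] have closed
    graphs.  A positive flag depends on finitely many first values of witnesses,
    hence passes to the limit; a null flag asserts that all of these first
    values vanish, which is a closed condition. *)
Lemma closed_graph_merge g :
  (forall m, closed_graph (g m)) -> closed_graph (merge_graphs g).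
Proof.
move=> cg a w H.
have gE m : g m a = fun k => w (pickle (m, k)).+1.
  apply: cg => n.
  have [a' [a'a /agreeP gw]] :=
    H (maxn n (\max_(k < n) (pickle (m, (k : nat))).+2)).
  exists a'; split; first by apply: agree_leq a'a; rewrite leq_maxl.
  apply/agreeP => i ltin; rewrite -gw ?merge_graphs_component //.
  rewrite leq_max; apply/orP; right.
  exact: (leq_bigmax (Ordinal ltin)).
(* Near the limit the flag and the first values of [g 0], ..., [g M] are
   exact. *)
have close M : exists2 a', forall m, (m <= M)%N -> g m a' 0 = g m a 0 &
    merge_graphs g a' 0 = w 0.
  have [a' [a'a /agreeP gw]] := H (\max_(k < M.+1) (pickle ((k : nat), 0)).+2).
  have big m : (m <= M)%N ->
      ((pickle (m, 0)).+1 < \max_(k < M.+1) (pickle ((k : nat), 0)).+2)%N.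
    by move=> leM; exact: (leq_bigmax (Ordinal (leM : (m < M.+1)%N))).
  exists a' => [m leM|]; last by rewrite gw // (leq_trans _ (big 0 _)).
  by rewrite gE -gw ?merge_graphs_component //; exact: big.
apply/funext => -[|j]; last first.
  case Ej : (@unpickle (nat * nat)%type j) => [[m k]|]; last first.
    have [a' [_ /agreeP gw]] := H j.+2.
    by rewrite -gw // /merge_graphs Ej.
  (* The code [j] of [(m, k)] may differ from [pickle (m, k)]; both positions
     are read off the same approximation. *)
  have [a' [_ /agreeP gw]] := H (maxn (pickle (m, k)).+2 j.+2).
  rewrite -gw ?leq_maxr // /merge_graphs Ej gE -gw ?leq_maxl //.
  by rewrite merge_graphs_component.
rewrite [LHS]/merge_graphs; case: pselect => [[m0 gm0]|nex].
  have [lP lmin] := leastP (P := fun m => g m a 0 <> 0) gm0.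
  move El : (least _) lP lmin => l lP lmin.
  have [a' a'a <-] := close l; rewrite /merge_graphs.
  have gl : g l a' 0 <> 0 by rewrite a'a.
  case: pselect => [?|nl]; last by case: nl; exists l.
  congr S; apply/esym/least_eqE; left; split; first exact: gl.
  move=> j ltjl.
  rewrite (a'a _ (ltnW ltjl)) => gj0.
  by have := lmin _ gj0; rewrite leqNgt ltjl.
have /forallNP ng := nex; case Ew : (w 0) => [//|k].
have [a' a'a] := close k; rewrite Ew /merge_graphs.
case: pselect => // ex [lk]; exfalso; case: ex => m0 gm0.
have [+ _] := leastP (P := fun m => g m a' 0 <> 0) gm0.
by rewrite lk (a'a _ (leqnn k)) => /ng.
Qed.

(** The sets decided in this way form a sigma-algebra containing the cylinders:
    complements by [closed_graph_complement], unions by [closed_graph_merge]. *)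
Lemma borel_closed_graph B : cyl_borel B ->
  exists2 g, closed_graph g & forall a, B a <-> g a 0 <> 0.
Proof.
suff : cyl_borel `<=`
    [set B | exists2 g, closed_graph g & forall a, B a <-> g a 0 <> 0].
  by exact.
apply: smallest_sub; last first.
  move=> _ [n [k ->]]; exists (fun a _ => nat_of_bool (a n == k)).
    exact: closed_graph_cylinder.
  by move=> a /=; case: eqP.
split.
- exists (fun _ _ => 0) => // a w H; apply/funext => i.
  by have [a' [_ /agreeP gw]] := H i.+1; exact: gw.
- move=> A [g cg gP]; eexists; first exact: (closed_graph_complement cg).
  move=> a /=; split=> [[_ /gP]|]; first by case: eqP.
  by case: eqP => // g0 _; split=> // /gP.
- move=> A H.
  have [g gP] : {g : nat -> (nat -> nat) -> nat -> nat &
      forall m, closed_graph (g m) /\ forall a, A m a <-> g m a 0 <> 0}.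
    apply: (@choice _ _ (fun m g =>
      closed_graph g /\ forall a, A m a <-> g a 0 <> 0)).
    by move=> m; have [g ? ?] := H m; exists g.
  exists (merge_graphs g); first by apply: closed_graph_merge => m; case: (gP m).
  move=> a; split=> [[m _ Am]|/merge_graphs_nonzero[m gm]].
    by apply/merge_graphs_nonzero; exists m; apply/(gP m).2.
  by exists m => //; apply/(gP m).2.
Qed.

(** Points of the plane are coded by single sequences, so that Borel sets of
    pairs are again members of [cyl_borel]. *)
Definition interleave (a b : nat -> nat) : nat -> nat :=
  fun n => if odd n then b n./2 else a n./2.
Definition evens (z : nat -> nat) : nat -> nat := fun n => z n.*2.
Definition odds (z : nat -> nat) : nat -> nat := fun n => z n.*2.+1.

Lemma evens_interleave a b : evens (interleave a b) = a.
Proof. by apply/funext => n; rewrite /evens /interleave odd_double doubleK. Qed.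

Lemma odds_interleave a b : odds (interleave a b) = b.
Proof.
apply/funext => n.
by rewrite /odds /interleave /= odd_double uphalf_double.
Qed.

Lemma interleave_evens_odds z : interleave (evens z) (odds z) = z.
Proof.
apply/funext => n; rewrite /interleave /evens /odds; case: ifP => on.
  by rewrite -[in RHS](odd_double_half n) on.
by rewrite -[in RHS](odd_double_half n) on.
Qed.

(** The closed relation links [a] to the pairs formed by a point [b] of the
    section of [B] and the witness of [(a, b)].  As the witness is unique, its
    sections are in bijection with those of [B]. *)
Lemma borel_uniformization (B : set (nat -> nat)) : cyl_borel B ->
  (forall a, countable [set b | B (interleave a b)]) ->
  exists2 f, measurable_family f &
    forall a b, B (interleave a b) -> exists j, f j a = b.
Proof.
move=> /borel_closed_graph[g cg gB] cB.
pose F a z := g (interleave a (evens z)) = odds z /\ odds z 0 <> 0.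
have clF : closed_rel F.
  move=> a z H; split.
    apply: cg => n; have [a' [z' [[gz _] /agreeP a'a /agreeP z'z]]] := H n.*2.+1.
    exists (interleave a' (evens z')); split; apply/agreeP => i ltin; last first.
      by rewrite gz /odds z'z // ltnS ltn_double.
    have hi : (i./2 < n.*2.+1)%N.
      rewrite ltnS (leq_trans (half_leq (ltnW ltin))) // -divn2 -addnn.
      by rewrite (leq_trans (leq_div _ _)) // leq_addr.
    rewrite /interleave /evens; case: ifP => _; last exact: a'a.
    rewrite z'z // ltnS (leq_trans (n := i)) //.
      by rewrite -[leqRHS](odd_double_half i) leq_addl.
    by rewrite -addnn (leq_trans (ltnW ltin)) // leq_addr.
  have [a' [z' [[_ z'0] _ /agreeP z'z]]] := H 2.
  by rewrite /odds -z'z.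
have cF a : countable [set z | F a z].
  pose pair b := interleave b (g (interleave a b)).
  apply: (@sub_countable _ _ _ (pair @` [set b | B (interleave a b)])).
    apply: subset_card_le => z [gz z0]; exists (evens z).
      by apply/gB; rewrite gz.
    by rewrite /pair gz interleave_evens_odds.
  exact: (sub_countable (card_image_le _ _) (cB a)).
have [f mf fP] := closed_uniformization clF cF.
exists (fun j a => evens (f j a)); first by move=> j n; exact: mf.
move=> a b /gB gb; have [|j fj] := fP a (interleave b (g (interleave a b))).
  by split; rewrite ?odds_interleave ?evens_interleave.
by exists j; rewrite fj evens_interleave.
Qed.

(** * Coding a standard Borel space by sequences of naturals *)

Section PolishCode.
Context {R : realType} {T : metricType R}.
Local Open Scope ring_scope.

Lemma dense_sequence (t0 : T) : @second_countable T ->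
  exists d : nat -> T, forall x (e : R), 0 < e -> exists k, mdist x (d k) < e.
Proof.
move=> [B cB [_ basisB]].
have [u uP] := countable_enum set0 cB.
have [d dP] : {d : nat -> T & forall k x, u k x -> u k (d k)}.
  apply: (@choice _ _ (fun k t => forall x, u k x -> u k t)) => k.
  have [[t ukt]|/forallNP nu] := pselect (exists t, u k t); first by exists t.
  by exists t0 => x /nu.
exists d => x e e0.
have [U [BU Ux] Ue] := basisB x _ (nbhsx_ballx x e e0).
have [k ukU] := uP _ BU; exists k.
have : ball x e (d k) by apply: Ue; rewrite -ukU; apply: (dP k x); rewrite ukU.
by rewrite ballEmdist.
Qed.

Lemma open_mdist_ball (x : T) (e : R) : open [set y | mdist y x < e].
Proof.
rewrite openE => y /= yx; rewrite /interior -nbhs_ballE.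
exists (e - mdist y x) => /=; first by rewrite subr_gt0.
move=> z; rewrite ballEmdist /= => yz.
have := metric_triangle z y x; rewrite (metric_sym z y) => h; lra.
Qed.

Context (d : nat -> T).
Hypothesis d_dense : forall x (e : R), 0 < e -> exists k, mdist x (d k) < e.
Hypothesis T_complete :
  forall F : set_system T, ProperFilter F -> cauchy F -> exists l : T, F --> l.

Let r (n : nat) : R := n.+1%:R^-1.

Let r_gt0 n : 0 < r n. Proof. by rewrite /r invr_gt0. Qed.

Let r_small (e : R) : 0 < e -> exists N, forall n, (N <= n)%N -> r n < e.
Proof.
move=> e0; exists (Num.truncn e^-1) => n leNn; rewrite /r invf_plt ?posrE //.
by rewrite (lt_le_trans (truncnS_gt _)) // ler_nat ltnS.
Qed.

(** Choosing the least index makes the cells of each level disjoint; they are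
    Borel, and of diameter at most [2 / n.+1] at level [n]. *)
Definition code (x : T) (n : nat) : nat := least (fun k => mdist x (d k) < r n).

Lemma code_close x n : mdist x (d (code x n)) < r n.
Proof.
have [k xk] := d_dense x (r_gt0 n).
by case: (leastP (P := fun k => mdist x (d k) < r n) xk).
Qed.

Lemma code_min x n k : mdist x (d k) < r n -> (code x n <= k)%N.
Proof.
move=> xk; have [_] := leastP (P := fun k => mdist x (d k) < r n) xk.
exact.
Qed.

(** Points in the same cell at all levels are at distance zero. *)
Lemma code_inj : injective code.
Proof.
move=> x y cxy; apply: mdist_positivity; apply/eqP.
rewrite eq_le mdist_ge0 andbT; apply/ler_addgt0Pl => e e0.
have [N /(_ _ (leqnn N)) rN] := r_small (divr_gt0 e0 (@ltr0n R 2)).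
have := metric_triangle x (d (code x N)) y.
have := code_close x N; have := code_close y N; rewrite -cxy.
rewrite (metric_sym y) => h1 h2 h3; lra.
Qed.

Lemma code_measurable n : measurable_fibers (@borel T) (code^~ n).
Proof.
have sB : sigma_algebra setT (@borel T) by exact: smallest_sigma_algebra.
apply: (fibers_least sB) => k; apply: sub_sigma_algebra => /=.
exact: open_mdist_ball.
Qed.

(** An open set is the union of the cells that it contains, since the cells
    around a point shrink. *)
Lemma borel_code_preimage A : @borel T A ->
  exists2 A', cyl_borel A' & A = [set x | A' (code x)].
Proof.
suff : @borel T `<=`
    [set A | exists2 A', cyl_borel A' & A = [set x | A' (code x)]].
  by exact.
apply: smallest_sub.
  split.
  - exists set0; last by apply/seteqP; split.
    exact: (sigma_cst cyl_sigma False).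
  - move=> _ [A' cA' ->]; exists [set a | ~ A' a].
      exact: (sigma_not cyl_sigma).
    by apply/seteqP; split=> x /=; [case|].
  - move=> AA H.
    have [A' A'P] : {A' : nat -> set (nat -> nat) & forall n,
        cyl_borel (A' n) /\ AA n = [set x | A' n (code x)]}.
      apply: (@choice _ _ (fun n B =>
        cyl_borel B /\ AA n = [set x | B (code x)])) => n.
      by have [B ? ?] := H n; exists B.
    exists [set a | exists n, A' n a].
      by apply: (sigma_exists cyl_sigma) => n; case: (A'P n).
    apply/seteqP; split=> x /= [n].
      by move=> _ Anx; exists n; move: Anx; case: (A'P n) => _ ->.
    by move=> A'nx; exists n => //; case: (A'P n) => _ ->.
move=> U oU; exists [set a | exists n, [set x | code x n = a n] `<=` U].
  apply: (sigma_exists cyl_sigma) => n.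
  exact: (fibers_pred cyl_sigma (fun k => [set x | code x n = k] `<=` U)
    (fibers_coord n)).
apply/seteqP; split=> x /=; last by case=> n; apply.
move=> Ux; have : nbhs x U by exact: open_nbhs_nbhs.
rewrite -nbhs_ballE => -[e /= e0 xeU].
have [N /(_ _ (leqnn N)) rN] := r_small (divr_gt0 e0 (@ltr0n R 2)).
exists N => y /= cyx; apply: xeU; rewrite ballEmdist /=.
have := metric_triangle x (d (code x N)) y.
have := code_close x N; have := code_close y N; rewrite cyx.
rewrite (metric_sym y) => h1 h2 h3; lra.
Qed.

(** The point coded by [a] is the limit of the [d (a n)], and the distance of
    this limit to a point [d k] is less than [r n] exactly when [mdist (d (a N))
    (d k) + r N < r n] for some [N]. The conditions say that the sequence is
    Cauchy with the expected speed, that its limit is within [r n] of [d (a n)],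
    and that no smaller index than [a n] has this property. They mention only
    countably many distances between points [d k], which makes the range Borel.
    *)
Lemma code_range : range code = [set a |
  (forall m n, mdist (d (a m)) (d (a n)) < r m + r n) /\
  (forall n, (exists N, mdist (d (a N)) (d (a n)) + r N < r n) /\
    forall k, (k < a n)%N -> forall N, ~ (mdist (d (a N)) (d k) + r N < r n))].
Proof.
apply/seteqP; split=> [_ [x _ <-]|a /= [ai aii]].
  split=> [m n|n].
    have := metric_triangle (d (code x m)) x (d (code x n)).
    have := code_close x m; have := code_close x n.
    rewrite (metric_sym _ x) => h1 h2 h3; lra.
  split=> [|k ltk N lt].
    have xn := code_close x n.
    have e0 : 0 < (r n - mdist x (d (code x n))) / 2.
      by rewrite divr_gt0 // subr_gt0.
    have [N /(_ _ (leqnn N)) rN] := r_small e0; exists N.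
    have := metric_triangle (d (code x N)) x (d (code x n)).
    have := code_close x N.
    rewrite (metric_sym _ x) => h1 h2; lra.
  suff /code_min : mdist x (d k) < r n by rewrite leqNgt ltk.
  have := metric_triangle x (d (code x N)) (d k); have := code_close x N.
  by move=> h1 h2; lra.
have [y dy] : exists y : T, (fun n => d (a n)) @ \oo --> y.
  apply: T_complete; apply: cauchy_exP => e e0.
  have [N rN] := r_small (divr_gt0 e0 (@ltr0n R 2)).
  exists (d (a N)); exists N => // n /= leNn; rewrite ballEmdist /=.
  have := ai N n; have := rN _ (leqnn N); have := rN _ leNn => h1 h2 h3; lra.
(* The Cauchy condition passes to the limit as a large inequality; the strict
   one comes back from the slack [r N]. *)
have ay n : mdist y (d (a n)) <= r n.
  apply/ler_addgt0Pl => e e0.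
  have e20 : 0 < e / 2 by rewrite divr_gt0.
  have [N rN] := r_small e20.
  have [M _ dM] := metricType_numDomainType.cvgr_dist_lt dy e20.
  have := rN _ (leq_maxl N M); have := dM _ (leq_maxr N M).
  have := ai (maxn N M) n.
  have := metric_triangle y (d (a (maxn N M))) (d (a n)) => /= h1 h2 h3 h4; lra.
exists y => //; apply/funext => n; have [[N aN] amin] := aii n.
apply/eqP; rewrite eqn_leq; apply/andP; split.
  apply: code_min; have := metric_triangle y (d (a N)) (d (a n)).
  have := ay N => h1 h2; lra.
rewrite leqNgt; apply/negP => lt.
have yc := code_close y n.
have e0 : 0 < (r n - mdist y (d (code y n))) / 2.
  by rewrite divr_gt0 // subr_gt0.
have [M /(_ _ (leqnn M)) rM] := r_small e0; apply: (amin _ lt M).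
have := metric_triangle (d (a M)) y (d (code y n)); have := ay M.
by rewrite (metric_sym _ y) => h1 h2; lra.
Qed.

Lemma range_code_measurable : cyl_borel (range code).
Proof.
rewrite code_range.
have pair m n (P : nat -> nat -> Prop) : cyl_borel [set a | P (a m) (a n)].
  exact: (fibers_pred cyl_sigma (fun p => P p.1 p.2)
    (fibers_pair cyl_sigma (fibers_coord m) (fibers_coord n))).
apply: (sigma_and cyl_sigma).
  apply: (sigma_forall cyl_sigma) => m.
  apply: (sigma_forall cyl_sigma) => n.
  exact: (pair m n (fun i j => mdist (d i) (d j) < r m + r n)).
apply: (sigma_forall cyl_sigma) => n; apply: (sigma_and cyl_sigma).
  apply: (sigma_exists cyl_sigma) => N.
  exact: (pair N n (fun i j => mdist (d i) (d j) + r N < r n)).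
apply: (sigma_forall cyl_sigma) => k.
rewrite (_ : mkset _ = [set a |
  forall N, (k < a n)%N -> ~ (mdist (d (a N)) (d k) + r N < r n)]).
  apply: (sigma_forall cyl_sigma) => N.
  exact: (pair N n (fun i j => (k < j)%N -> ~ (mdist (d i) (d k) + r N < r n))).
by apply/seteqP; split=> a /= H *; exact: H.
Qed.

End PolishCode.

Lemma standard_borel_sigma (R : realType) (X : Type) (S : set (set X)) :
  standard_borel R S -> sigma_algebra setT S.
Proof.
move=> [T [f [_ _ ->]]].
rewrite (_ : image _ _ = preimage_set_system setT f (@borel T)).
  by apply: sigma_algebra_preimage; exact: smallest_sigma_algebra.
by apply/seteqP; split=> _ [B bB <-]; exists B => //; rewrite setTI.
Qed.

(** The code of the underlying Polish space, transported to [X]. *)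
Lemma standard_borel_code (R : realType) (X : Type) (S : set (set X)) (x0 : X) :
  standard_borel R S -> exists c : X -> nat -> nat,
  [/\ injective c,
    forall n, measurable_fibers S (c^~ n),
    forall A, S A -> exists2 A', cyl_borel A' & A = [set x | A' (c x)]
  & cyl_borel (range c)].
Proof.
move=> [T [f [[scT complT] bijf ->]]].
have [d dP] := dense_sequence (f x0) scT.
exists (code d \o f); split.
- by apply: inj_comp; [exact: (code_inj dP)|exact: bij_inj].
- by move=> n k; exists [set t | code d t n = k] => //; exact: code_measurable.
- move=> _ [B /(borel_code_preimage dP)[A' cA' ->] <-]; exists A' => //.
- rewrite (_ : range _ = range (code d)); first exact: range_code_measurable.
  apply/seteqP; split=> _ [x _ <-]; first by exists (f x).
  by have [g _ gK] := bijf; exists (g x) => //=; rewrite gK.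
Qed.

(** * Borel maps into the Baire space and its sequences *)

(** The product topology is the supremum of the initial topologies of the
    coordinates; stated for an arbitrary topological space [V], it applies also
    when [V] is itself a product. *)
Lemma ptws_cvg (V : topologicalType) (F : set_system {ptws nat -> V})
    (f : {ptws nat -> V}) : Filter F ->
  (forall i, (fun g : {ptws nat -> V} => g i) @ F --> f i) -> F --> f.
Proof.
move=> FF Ff; apply/cvg_sup => i A /= [_ [[B oB <-] Bfi] sBA].
by apply: (filterS sBA); apply: (Ff i); exact: open_nbhs_nbhs.
Qed.

Lemma ptws_eval_continuous (V : topologicalType) n :
  continuous (fun g : {ptws nat -> V} => g n).
Proof. exact: (@proj_continuous nat (fun=> V) n). Qed.

Lemma cvg_baire (u : nat -> baire) (z : baire) :
  (forall i, exists N, forall n, (N <= n)%N -> u n i = z i) -> u @ \oo --> z.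
Proof.
move=> H; apply: ptws_cvg => i A Az; have [N uN] := H i.
by exists N => // n /= leNn; rewrite /= uN //; exact: nbhs_singleton.
Qed.

(** Otherwise points outside [U] that agree with [z] further and further
    converge to [z]. *)
Lemma open_baire (U : set baire) (z : baire) : open U -> U z ->
  exists n, forall z' : baire, mkseq z' n = mkseq z n -> U z'.
Proof.
move=> oU Uz; apply: contrapT => /forallNP H.
have [u uP] : {u : nat -> baire &
    forall n, mkseq (u n) n = mkseq z n /\ ~ U (u n)}.
  apply: (@choice _ _ (fun n (t : baire) =>
    mkseq t n = mkseq z n /\ ~ U t)) => n.
  by have /existsNP[t /not_implyP[? ?]] := H n; exists t.
have uz : u @ \oo --> z.
  apply: cvg_baire => i; exists i.+1 => n ltin.
  by have /agreeP -> := (uP n).1.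
have [N _ /(_ _ (leqnn N))] : (u @ \oo) U by apply: uz; exact: open_nbhs_nbhs.
by have [] := uP N.
Qed.

(** Same argument as for [open_baire], with the squares of side [n] as finite
    information. *)
Lemma open_baire_seq (U : set baire_seq) (z : baire_seq) : open U -> U z ->
  exists n, forall z' : baire_seq,
    mkseq (fun i => mkseq (z' i) n) n = mkseq (fun i => mkseq (z i) n) n ->
    U z'.
Proof.
move=> oU Uz; apply: contrapT => /forallNP H.
pose pat n (t : baire_seq) := mkseq (fun i => mkseq (t i) n) n.
have [u uP] : {u : nat -> baire_seq &
    forall n, pat n (u n) = pat n z /\ ~ U (u n)}.
  apply: (@choice _ _ (fun n (t : baire_seq) =>
    pat n t = pat n z /\ ~ U t)) => n.
  by have /existsNP[t /not_implyP[? ?]] := H n; exists t.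
have uz : u @ \oo --> z.
  apply: ptws_cvg => i; apply: cvg_baire => j; exists (maxn i j).+1 => n.
  rewrite gtn_max => /andP[ltin ltjn]; have [+ _] := uP n.
  move=> /(congr1 (fun s => nth [::] s i)); rewrite !nth_mkseq //.
  by move=> /agreeP; apply.
have [N _ /(_ _ (leqnn N))] : (u @ \oo) U by apply: uz; exact: open_nbhs_nbhs.
by have [] := uP N.
Qed.

(** Countably many patterns [pat n] that decide membership in open sets show
    that open sets are countable unions of pattern classes, uniformly in the
    points; this covers the Baire space and its countable power at once. *)
Lemma borel_fun_patterns (X : Type) (S : set (set X))
    (V : topologicalType) (Y : countType) (pat : nat -> V -> Y) (phi : X -> V) :
  sigma_algebra setT S ->
  (forall (U : set V) (z : V), open U -> U z ->
    exists n, forall z', pat n z' = pat n z -> U z') ->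
  (forall n, measurable_fibers S (fun x => pat n (phi x))) ->
  borel_fun S (@borel V) phi.
Proof.
move=> hS Hpat mpat.
suff : @borel V `<=` [set B | S [set x | B (phi x)]] by exact.
apply: smallest_sub.
  split.
  - exact: (sigma_cst hS False).
  - move=> A SA /=; rewrite (_ : mkset _ = [set x | ~ A (phi x)]).
      exact: (sigma_not hS).
    by apply/seteqP; split=> x //=; case.
  - move=> A SA /=; rewrite (_ : mkset _ = [set x | exists n, A n (phi x)]).
      exact: (sigma_exists hS).
    by apply/seteqP; split=> x /= [n]; exists n.
move=> U oU /=.
rewrite (_ : mkset _ = [set x | exists n,
    [set z | pat n z = pat n (phi x)] `<=` U]).
  apply: (sigma_exists hS) => n.
  exact: (fibers_pred hS (fun y => [set z | pat n z = y] `<=` U) (mpat n)).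
apply/seteqP; split=> x /=; last by case=> n; apply.
by move=> Ux; have [n] := Hpat U _ oU Ux; exists n.
Qed.

Lemma borel_fun_open_preimage (X : Type) (S : set (set X)) (V : topologicalType)
    (W : topologicalType) (e : V -> W) (phi : X -> V) (A : set W) :
  continuous e -> open A -> borel_fun S (@borel V) phi ->
  S [set x | A (e (phi x))].
Proof.
move=> ce oA bphi; apply: (bphi (e @^-1` A)); apply: sub_sigma_algebra.
by apply: open_comp => // x _; exact: ce.
Qed.

Lemma borel_fun_baire (X : Type) (S : set (set X)) (phi : X -> baire) :
  sigma_algebra setT S ->
  borel_fun S (@borel baire) phi <->
  forall n, measurable_fibers S (fun x => phi x n).
Proof.
move=> hS; split=> [bphi n k|mphi].
  exact: (borel_fun_open_preimage (@ptws_eval_continuous nat n)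
    (discrete_open [set k]) bphi).
apply: (borel_fun_patterns (pat := fun n (z : baire) => mkseq z n)) => //.
  exact: open_baire.
by move=> n; exact: (fibers_mkseq hS).
Qed.

Lemma borel_fun_baire_seq (X : Type) (S : set (set X)) (phi : X -> baire_seq) :
  sigma_algebra setT S ->
  borel_fun S (@borel baire_seq) phi <->
  forall n m, measurable_fibers S (fun x => phi x n m).
Proof.
move=> hS; split=> [bphi n m k|mphi].
  apply: (borel_fun_open_preimage (e := fun z : baire_seq => z n m)
    _ (discrete_open [set k]) bphi) => z.
  apply: (@continuous_comp baire_seq baire nat (fun z => z n) (fun z => z m)).
    exact: ptws_eval_continuous.
  exact: ptws_eval_continuous.
apply: (borel_fun_patterns
  (pat := fun n (z : baire_seq) => mkseq (fun i => mkseq (z i) n) n)) => //.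
  exact: open_baire_seq.
move=> n; apply: (fibers_mkseq hS (g := fun x i => mkseq (phi x i) n)) => i.
exact: (fibers_mkseq hS).
Qed.

(** * Enumerating the classes of a countable Borel equivalence relation *)

(** Transport [E] through the code [c] to a Borel set [B] of pairs with
    countable sections. The functions of [borel_uniformization] yield candidates
    for codes of the members of the class of [x]; a candidate that is not one is
    replaced by [x] itself, which keeps the enumeration inside the class. *)
Lemma class_enumeration (R : realType) (X : Type) (S : set (set X))
    (E : X -> X -> Prop) (x0 : X) :
  standard_borel R S -> countable_borel_equivalence S E ->
  exists e : nat -> X -> X, [/\ forall A j, S A -> S (e j @^-1` A),
    forall j x, E x (e j x) & forall x y, E x y -> exists j, e j x = y].
Proof.
move=> sbS [eqE bE cE].
have hS := standard_borel_sigma sbS.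
have [c [c_inj c_meas c_pre c_range]] := standard_borel_code x0 sbS.
have [E' cE' EE'] : exists2 E', cyl_borel E' &
    forall x y, E x y <-> E' (interleave (c x) (c y)).
  suff : product_sigma S S `<=` [set A | exists2 A', cyl_borel A' &
      forall x y, A (x, y) <-> A' (interleave (c x) (c y))].
    by move=> /(_ _ bE).
  have m_evens n : measurable_fibers cyl_borel (fun z => evens z n).
    by move=> k; exact: fibers_coord.
  have m_odds n : measurable_fibers cyl_borel (fun z => odds z n).
    by move=> k; exact: fibers_coord.
  apply: smallest_sub.
    split.
    - by exists set0 => //; exact: (sigma_cst cyl_sigma False).
    - move=> A [A' cA' AA']; exists [set a | ~ A' a].
        exact: (sigma_not cyl_sigma).
      by move=> x y /=; rewrite -AA'; split=> [[]|].
    - move=> A H.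
      have [A' A'P] : {A' : nat -> set (nat -> nat) & forall n,
          cyl_borel (A' n) /\
          forall x y, A n (x, y) <-> A' n (interleave (c x) (c y))}.
        apply: (@choice _ _ (fun n B => cyl_borel B /\
          forall x y, A n (x, y) <-> B (interleave (c x) (c y)))) => n.
        by have [B ? ?] := H n; exists B.
      exists [set a | exists n, A' n a].
        by apply: (sigma_exists cyl_sigma) => n; case: (A'P n).
      move=> x y; split=> [[n _ Axy]|[n A'xy]]; exists n => //.
        exact/(A'P n).2.
      exact/(A'P n).2.
  move=> _ [A SA [B SB <-]].
  have [A' cA' ->] := c_pre A SA; have [B' cB' ->] := c_pre B SB.
  exists [set z | A' (evens z) /\ B' (odds z)].
    by apply: (sigma_and cyl_sigma); exact: cyl_borel_preimage.
  by move=> x y /=; rewrite evens_interleave odds_interleave.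
(* Restricting to codes is needed for countable sections: [E'] is arbitrary
   off the range of [c]. *)
pose B := [set z | E' z /\ (range c (evens z) /\ range c (odds z))].
have cB : cyl_borel B.
  apply: (sigma_and cyl_sigma) => //; apply: (sigma_and cyl_sigma).
    by apply: (cyl_borel_preimage (c := evens)) => // n k; exact: fibers_coord.
  by apply: (cyl_borel_preimage (c := odds)) => // n k; exact: fibers_coord.
have BE x y : B (interleave (c x) (c y)) <-> E x y.
  rewrite EE' /B /= evens_interleave odds_interleave.
  split=> [[]//|?]; split => //.
  by split; [exists x|exists y].
have cntB a : countable [set b | B (interleave a b)].
  have [[x xa]|nx] := pselect (exists x, c x = a).
    apply: (@sub_countable _ _ _ (c @` [set y | E x y])).
      apply: subset_card_le => b /= Bab; have [_ [_ [y _ yb]]] := Bab.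
      rewrite odds_interleave in yb; exists y => //=; apply/BE.
      by rewrite xa yb.
    exact: (sub_countable (card_image_le _ _) (cE x)).
  rewrite (_ : mkset _ = set0) //.
  apply/seteqP; split=> b //= [_ [[x _ xa] _]]; apply: nx; exists x.
  by rewrite xa evens_interleave.
have [f mf fP] := borel_uniformization cB cntB.
have [e eP] : {e : nat * X -> X & forall jx,
    (E jx.2 (e jx) /\ c (e jx) = f jx.1 (c jx.2)) \/
    (~ B (interleave (c jx.2) (f jx.1 (c jx.2))) /\ e jx = jx.2)}.
  apply: (@choice _ _ (fun (jx : nat * X) y =>
    (E jx.2 y /\ c y = f jx.1 (c jx.2)) \/
    (~ B (interleave (c jx.2) (f jx.1 (c jx.2))) /\ y = jx.2))) => -[j x] /=.
  have [Bx|nB] := pselect (B (interleave (c x) (f j (c x)))); last first.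
    by exists x; right.
  have [_ [_ [y _]]] := Bx; rewrite odds_interleave => yf.
  by exists y; left; split=> //; apply/BE; rewrite yf.
have m_fc j n : measurable_fibers S (fun x => f j (c x) n).
  by move=> k; exact: (cyl_borel_preimage hS c_meas (mf j n k)).
have S_B j : S [set x | B (interleave (c x) (f j (c x)))].
  apply: (cyl_borel_preimage (c := fun x => interleave (c x) (f j (c x)))
    hS _ cB) => n.
  by rewrite /interleave; case: odd; [exact: m_fc|exact: c_meas].
exists (fun j x => e (j, x)); split.
- move=> A j SA; have [A' cA' AA'] := c_pre A SA.
  rewrite (_ : preimage _ _ = [set x |
    (B (interleave (c x) (f j (c x))) /\ A' (f j (c x))) \/
    (~ B (interleave (c x) (f j (c x))) /\ A x)]).
    apply: (sigma_or hS); apply: (sigma_and hS) => //;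
      last exact: (sigma_not hS).
    exact: (cyl_borel_preimage hS (m_fc j) cA').
  apply/seteqP; split=> x /=.
    case: (eP (j, x)) => /= [[Ex ce]|[nB ->]]; last by right.
    by rewrite [in A _]AA' /= ce => ?; left; split => //; rewrite -ce; apply/BE.
  case: (eP (j, x)) => /= [[Ex ce]|[nB ->]] [[h1 h2]|[h1 h2]] //.
    by rewrite AA' /= ce.
  by case: h1; rewrite -ce; apply/BE.
- move=> j x; case: (eP (j, x)) => /= [[]//|[_ ->]].
  by case: eqE => r _ _; exact: r.
- move=> x y Exy; have [j fj] : exists j, f j (c x) = c y by apply/fP/BE.
  exists j; case: (eP (j, x)) => /= [[_ ce]|[nB _]].
    by apply: c_inj; rewrite ce.
  by case: nB; rewrite fj; apply/BE.
Qed.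

(** * Eventual domination, and the equivalence *)

Lemma le_star_trans a b c : le_star a b -> le_star b c -> le_star a c.
Proof.
move=> ab bc; apply: (@sub_finite_set _ _
  ([set n | ~ (a n <= b n)%N] `|` [set n | ~ (b n <= c n)%N])).
  move=> n /= ac; apply: contrapT => /not_orP[/contrapT h1 /contrapT h2].
  by apply: ac; exact: leq_trans h2.
by rewrite finite_setU.
Qed.

Lemma le_star_from N a b :
  (forall n, (N <= n)%N -> (a n <= b n)%N) -> le_star a b.
Proof.
move=> H; apply: (sub_finite_set _ (finite_II N)) => n /= nab.
by rewrite ltnNge; apply/negP => /H.
Qed.

Theorem proposition4p5 (R : realType) (X : Type) (S : set (set X))
    (E : X -> X -> Prop)
    (hX : standard_borel R S)
    (hE : countable_borel_equivalence S E) :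
  (forall phi : X -> baire, borel_fun S (@borel baire) phi ->
     exists psi : X -> baire,
       borel_hom S (@borel baire) E E0 psi /\
       forall x, le_star (phi x) (psi x))
  <->
  (forall phi : X -> baire_seq,
     borel_hom S (@borel baire_seq) E Eset phi ->
     exists psi : X -> baire,
       borel_hom S (@borel baire) E E0 psi /\
       forall x (n : nat), le_star (phi x n) (psi x)).
Proof.
have hS := standard_borel_sigma hX.
have [[x0 _]|nX] := pselect (exists x : X, True); last first.
  (* On the empty space any map works; the code needs a point of [X]. *)
  have hzero : borel_hom S (@borel baire) E E0 (fun _ _ => 0).
    split=> [|x]; last by case: nX; exists x.
    by apply/(borel_fun_baire _ hS) => n k; exact: (sigma_cst hS (0 = k)).
  by split=> _ phi _; exists (fun _ _ => 0); split=> // x; case: nX; exists x.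
split=> [H phi [/(borel_fun_baire_seq _ hS) mphi _]
        |H phi /(borel_fun_baire _ hS) mphi].
  pose phi' x : baire := fun k => \max_(i <- mkseq (fun n => phi x n k) k.+1) i.
  have bphi' : borel_fun S (@borel baire) phi'.
    apply/(borel_fun_baire _ hS) => k.
    apply: (fibers_comp hS (fun s : seq nat => \max_(i <- s) i)).
    by apply: (fibers_mkseq hS (g := fun x n => phi x n k)).
  have [psi [hpsi lepsi]] := H _ bphi'; exists psi; split=> // x n.
  apply: le_star_trans (lepsi x); apply: (@le_star_from n) => k lenk.
  apply: (@leq_bigmax_seq _ _ xpredT id) => //.
  by apply/mapP; exists n => //; rewrite mem_iota ltnS.
have [e [e_meas e_class e_surj]] := class_enumeration x0 hX hE.
have [[Erefl Esym Etrans] _ _] := hE.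
have incl x x' : E x x' ->
    range (fun j => phi (e j x)) `<=` range (fun j => phi (e j x')).
  move=> Exx' _ [j _ <-]; have [j' ej'] : exists j', e j' x' = e j x.
    by apply: e_surj; apply: (Etrans _ x); [exact: Esym|exact: e_class].
  by exists j' => //; rewrite ej'.
have hPhi : borel_hom S (@borel baire_seq) E Eset (fun x j => phi (e j x)).
  split=> [|x x' Exx'].
    apply/(borel_fun_baire_seq _ hS) => j m k.
    by apply: (e_meas [set x | phi x m = k]); exact: mphi.
  by apply/seteqP; split; apply: incl => //; exact: Esym.
have [psi [hpsi lepsi]] := H _ hPhi.
exists psi; split => // x; have [j ej] := e_surj x x (Erefl x).
by have := lepsi x j; rewrite ej.
Qed.
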